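(* Let $K$ be a nontrivial finitely generated group with the left-invariant Cayley metric of a fixed finite generating set. If $K$ satisfies property $(P_{10}')$, then $K$ is a $TS$ group. Also, if $K$ satisfies property $(P)$, then $K$ is a $TS$ group.
   Context: For a group $K$ with a fixed finite generating set, $|g|$ denotes the word length of $g$ (distance to $1$ in the left-invariant Cayley metric). A finite sequence is called $n$-aperiodic ($n\ge 1$) if it does not contain $n+1$ consecutive (adjacent) identical nonempty blocks. Property $(P)$: for any $r>0$ there exists $\xi\in K$ such that $|\xi^{\epsilon_1}x_1\xi^{\epsilon_2}x_2\cdots\xi^{\epsilon_k}x_k|>r$ for every $k\ge 1$, all $x_1,\dots,x_k\in K$ with $x_i\ne 1$ and $|x_i|\le r$, and all $\epsilon_i\in\{+1,-1\}$. Property $(P_n')$ (for a positive integer $n$): for any $r>0$ there exists $\xi\in K$ such that for every $k\ge 1$, every $n$-aperiodic sequence $x_1,\dots,x_k$ of elements of $K$ with $x_i\neq 1$ and $|x_i|\le r$, and all $\epsilon_i\in\{+1,-1\}$, one has $|\xi^{\epsilon_1}x_1\cdots\xi^{\epsilon_k}x_k|>r$. For $\xi\in\Gamma$, a subset $B\subseteq \Gamma$ of a group is $\{\xi\}$-related (or $\xi$-related) if for any $x\in B$ there exists $y\in B$ such that $y^{-1}x=\xi$ or $x^{-1}y=\xi$. For a finite subset $Y$ of $\Gamma$, $L(Y)$ is the minimal length of a closed path in the Cayley graph of $\Gamma$ (with respect to the fixed generating set) passing through all elements of $Y$. A finitely generated group $\Gamma$ is a $TS$ group if for any $\lambda>1$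 there exists $\xi\in\Gamma$ such that for every finite $\{\xi\}$-related set $S\subseteq\Gamma$, $L(S)\ge\lambda|S|$, where $|S|$ is the cardinality of $S$. (This is independent of the choice of finite generating set.) *)

(* Defs.v *)
From HB Require Import structures.
From mathcomp Require Import all_boot all_order all_algebra finmap.
From mathcomp Require Import boolp classical_sets reals.

Set Implicit Arguments.
Unset Strict Implicit.
Unset Printing Implicit Defensive.

Import Order.TTheory GRing.Theory Num.Theory.

Local Open Scope classical_set_scope.
Local Open Scope group_scope.

(* The default value 0 is taken only on the empty set, which does not arise
   below as soon as A generates K. *)
Definition least (S : set nat) : nat :=
  xget 0%N [set n | S n /\ forall m, S m -> (n <= m)%N].

Section CayleyGraph.
Variables (K : groupType) (A : seq K).

(* A need not be symmetric. *)
Definition letters : seq K := A ++ [seq a^-1 | a <- A].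

Definition spells (w : seq K) (g : K) : Prop :=
  {subset w <= letters} /\ \prod_(a <- w) a = g.

Definition generates : Prop := forall g : K, exists w, spells w g.

Definition word_length (g : K) : nat :=
  least [set n | exists2 w, spells w g & size w = n].

(* Edges x -- x * a: left translations are graph automorphisms. *)
Definition cayley_edge : rel K := [rel x y | x^-1 * y \in letters].

(* The vertices of the path are x :: p and its length, the number of edges,
   is size p; it is closed when last x p = x.  The library's cycle is not used
   as it would exclude the path of length 0 at x. *)
Definition closed_path_length (Y : {fset K}) : nat :=
  least [set n | exists x p,
    [/\ path cayley_edge x p, last x p = x, {subset Y <= x :: p}
      & size p = n]].

End CayleyGraph.

Definition aperiodic (T : eqType) (n : nat) (s : seq T) : Prop :=
  forall b : seq T, b != [::] -> ~~ infix (flatten (nseq n.+1 b)) s.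

(* A sign is a boolean, true standing for -1 as in (-1) ^+ b. *)
Definition sign_pow (K : groupType) (xi : K) (b : bool) : K :=
  if b then xi^-1 else xi.

Definition alternating_product (K : groupType) (xi : K) (k : nat)
    (e : k.-tuple bool) (x : k.-tuple K) : K :=
  \prod_(i < k) (sign_pow xi (tnth e i) * tnth x i).

Definition property_P (R : realType) (K : groupType) (A : seq K) : Prop :=
  forall r : R, (0 < r)%R -> exists xi : K,
    forall (k : nat) (x : k.-tuple K) (e : k.-tuple bool), (1 <= k)%N ->
      (forall i, tnth x i != 1 /\ ((word_length A (tnth x i))%:R <= r)%R) ->
      (r < (word_length A (alternating_product xi e x))%:R)%R.

Definition property_P' (R : realType) (K : groupType) (A : seq K) (n : nat) :
    Prop :=
  forall r : R, (0 < r)%R -> exists xi : K,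
    forall (k : nat) (x : k.-tuple K) (e : k.-tuple bool), (1 <= k)%N ->
      aperiodic n x ->
      (forall i, tnth x i != 1 /\ ((word_length A (tnth x i))%:R <= r)%R) ->
      (r < (word_length A (alternating_product xi e x))%:R)%R.

Definition related (K : groupType) (xi : K) (B : set K) : Prop :=
  forall x, B x -> exists2 y, B y & y^-1 * x = xi \/ x^-1 * y = xi.

Definition ts_group (R : realType) (K : groupType) (A : seq K) : Prop :=
  forall lambda : R, (1 < lambda)%R -> exists xi : K,
    forall S : {fset K}, related xi [set` S] ->
      (lambda * (#|` S|)%:R <= (closed_path_length A S)%:R)%R.

(* Main.v *)
Require Import Defs.
From mathcomp Require Import all_boot all_order all_algebra finmap.
From mathcomp Require Import boolp classical_sets reals zify.

Set Implicit Arguments.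
Unset Strict Implicit.
Unset Printing Implicit Defensive.

Import Order.TTheory GRing.Theory Num.Theory.

(** Let S be a finite xi-related set and suppose that a closed path of length
L < lambda |S| passes through it.  Cut the path into pieces of length l, with
l large compared with lambda.  The pieces are few compared with |S|, so most
points of S share their piece with many other points of S; discarding the
points that do not, and then the points that have lost all their neighbours
z xi and z xi^-1, leaves a nonempty xi-related set T in which every point
shares its piece with at least four others ([related_core]).

In T one can walk for ever, alternating a jump to a neighbour along xi or
xi^-1 with a step of length less than l to another point of the same piece.
Since T is finite the walk comes back to a vertex, and reading it between two
visits gives a product of factors xi^(+-1) x_i equal to 1, with every x_i
nontrivial and short.  This refutes property (P) at once.  For (P'_n) the word
of the x_i must moreover be aperiodic.  Distinct choices of the next point
give distinct letters x_i, so that the words read along such walks form a tree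
in which every node has at least four children, and a tree of this kind
contains arbitrarily long square-free words ([squarefree_grown]).  This is a
counting argument: if the number g_k of square-free words of length k at least
doubles up to k = n, then of the 4 g_n extensions of the words of length n at
most g_0 + ... + g_n <= 2 g_n contain a square, because a word b b v whose
tail b v is square-free is determined by b v and the length of b; hence
g_(n+1) >= 2 g_n.

Cutting into pieces costs one extra piece, harmless once L >= l.  This holds
because the path joins two points that differ by xi^(+-1), and xi itself is
long: xi^(+-1) a is long for any generator a <> 1, and such an a exists since K
is nontrivial.

The argument applies to (P'_n) for every n >= 1 ([property_P'_ts]). *)

(** * Square-free words in trees *)

Section AperiodicWords.
Variable T : eqType.
Implicit Types (s u v w : seq T) (n p : nat).

Lemma aperiodic_infix n u v : infix u v -> aperiodic n v -> aperiodic n u.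
Proof. by move=> uv vn b b0; apply: contra (vn b b0) => /infix_trans; apply. Qed.

Lemma aperiodicW m n s : (m <= n)%N -> aperiodic m s -> aperiodic n s.
Proof.
move=> mn sm b b0; apply: contra (sm b b0) => /(infix_trans _); apply.
by rewrite -(subnKC mn) -addSn nseqD flatten_cat prefix_infix.
Qed.

Lemma aperiodic_seq1 n (a : T) : (0 < n)%N -> aperiodic n [:: a].
Proof.
move=> n0; apply: (aperiodicW n0) => b b0; rewrite infixs1 /= cats0.
case: b b0 => // x b _; rewrite -size_eq0 /=.
by apply: contraT => /negPn/eqP [_] /(congr1 size); rewrite size_cat /= addnS.
Qed.

Variable next : seq T -> seq T.

(** Words grow at their head: [next w] lists the letters that may be put in
front of [w], and the grown words are the nodes of the tree so described. *)
Fixpoint grown w : bool :=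
  if w is a :: w' then (a \in next w') && grown w' else true.

Lemma grown_drop p w : grown w -> grown (drop p w).
Proof. by elim: p w => [|p IHp] [|a w] //= /andP[_]; apply: IHp. Qed.

Definition starts_square w : bool :=
  has (fun p => prefix (take p w) (drop p w)) (iota 1 (size w)).

Definition grow (L : seq (seq T)) : seq (seq T) :=
  [seq a :: w | w <- L, a <- next w].

Fixpoint layer n : seq (seq T) :=
  if n is m.+1 then [seq w <- grow (layer m) | ~~ starts_square w]
  else [:: [::]].

Lemma mem_grow L a w : (a :: w \in grow L) = (w \in L) && (a \in next w).
Proof.
apply/allpairsPdep/andP => [[v [b [vL bv [-> ->]]]]|[wL aw]] //.
by exists w, a.
Qed.

Lemma layer_consP n w : w \in layer n.+1 ->
  exists a v, [/\ w = a :: v, v \in layer n, a \in next v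
                & ~~ starts_square w].
Proof.
rewrite /= mem_filter => /andP[wsq /allpairsPdep[v [a [vn av def_w]]]].
by exists a, v.
Qed.

Lemma size_layer n w : w \in layer n -> size w = n.
Proof.
elim: n w => [|n IHn] w; first by rewrite inE => /eqP->.
by case/layer_consP=> a [v [-> /IHn <-]].
Qed.

Lemma grown_layer n w : w \in layer n -> grown w.
Proof.
elim: n w => [|n IHn] w; first by rewrite inE => /eqP->.
by case/layer_consP=> a [v [-> /IHn /= -> ->]].
Qed.

Lemma drop_layer n p w : w \in layer n -> drop p w \in layer (n - p).
Proof.
elim: n p w => [|n IHn] [|p] w; rewrite ?drop0 ?subn0 //.
  by rewrite inE => /eqP->.
by case/layer_consP=> a [v [-> vn _ _]] /=; rewrite subSS IHn.
Qed.

Lemma starts_squareP b w :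
  b != [::] -> prefix (b ++ b) w -> starts_square w.
Proof.
move=> b0 /prefixP[s ->]; apply/hasP; exists (size b).
  by rewrite mem_iota -catA size_cat lt0n size_eq0 b0 add1n ltnS leq_addr.
by rewrite -catA take_size_cat // drop_size_cat // prefix_prefix.
Qed.

Lemma aperiodic_layer n w : w \in layer n -> aperiodic 1 w.
Proof.
elim: n w => [|n IHn] w wn b b0; rewrite /= cats0.
  by move: wn; rewrite inE => /eqP->; case: b b0.
case/layer_consP: wn => a [v [def_w vn _ wsq]]; rewrite def_w infix_consl.
rewrite -def_w negb_or; apply/andP; split.
  by apply: contra wsq => /(starts_squareP b0).
by have := IHn v vn b b0; rewrite /= cats0.
Qed.

Hypothesis next_wide : forall w,
  grown w -> uniq (next w) /\ (4 <= size (next w))%N.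

Lemma uniq_grow L : uniq L -> {in L, forall w, grown w} -> uniq (grow L).
Proof.
move=> uL gL; apply: allpairs_uniq_dep => //.
  by move=> w /gL /next_wide[].
by move=> [w a] [v b] _ _ /= [-> ->].
Qed.

Lemma uniq_layer n : uniq (layer n).
Proof.
elim: n => [|n IHn] //=; apply/filter_uniq/uniq_grow => // w.
exact: grown_layer.
Qed.

Lemma size_grow_layer n : (4 * size (layer n) <= size (grow (layer n)))%N.
Proof.
rewrite size_allpairs_dep; have := @grown_layer n.
elim: (layer n) => //= w L IHL gL; rewrite mulnS leq_add //.
  by have [] := next_wide (gL w (mem_head _ _)).
by apply: IHL => v vL; apply: gL; rewrite inE vL orbT.
Qed.

(** A square b b v in front of a word whose tail is in [layer n] is recovered
from b v, which lies in [layer j] for j = n + 1 - |b|, by repeating its first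
n + 1 - j letters. *)
Lemma size_grow_squares n :
  (count starts_square (grow (layer n)) <= \sum_(j < n.+1) size (layer j))%N.
Proof.
pose ext j := [seq take (n.+1 - j) w ++ w | w <- layer j].
have ->: (\sum_(j < n.+1) size (layer j)
    = size (flatten [seq ext j | j <- iota 0 n.+1]))%N.
  rewrite size_flatten sumnE /shape -map_comp big_map.
  rewrite -(big_mkord xpredT (size \o layer)).
  by rewrite /index_iota subn0; apply: eq_bigr => j _; rewrite /= size_map.
rewrite -size_filter; apply: uniq_leq_size => [|[|a v]].
- by apply/filter_uniq/uniq_grow => [|w]; [apply: uniq_layer|apply: grown_layer].
- by rewrite mem_filter andbC => /andP[/allpairsPdep[? [? []]]].
rewrite mem_filter mem_grow => /andP[/hasP[p]]; rewrite mem_iota.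
move=> /andP[p0 p_le] p_sq /andP[vn _]; have sv := size_layer vn.
rewrite [size _]/= add1n sv ltnS in p_le.
have dn : drop p (a :: v) \in layer (n.+1 - p).
  by case: p p0 {p_sq p_le} => // p _; rewrite /= subSS drop_layer.
apply/flatten_mapP; exists (n.+1 - p)%N.
  by rewrite mem_iota; lia.
apply/mapP; exists (drop p (a :: v)) => //.
rewrite subKn //; move: p_sq; rewrite prefixE size_takel /= ?sv // => /eqP.
by move=> ->; rewrite cat_take_drop.
Qed.

(** Of the at least 4 g_n extensions of the words of length n, where
g_j = size (layer j), at most g_0 + ... + g_n start with a square, and that sum
is at most 2 g_n by doubling at the earlier stages. *)
Lemma layer_doubles n : (2 * size (layer n) <= size (layer n.+1))%N.
Proof.
have step m : (\sum_(j < m.+1) size (layer j) <= 2 * size (layer m))%N ->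
    (2 * size (layer m) <= size (layer m.+1))%N.
  have := count_predC starts_square (grow (layer m)).
  rewrite -[count (predC _) _]size_filter.
  rewrite -[size (filter (predC _) _)]/(size (layer m.+1)).
  by have := size_grow_layer m; have := size_grow_squares m; lia.
apply: (step n); elim: n => [|n IHn]; first by rewrite big_ord1.
by rewrite big_ord_recr mul2n -addnn leq_add2r (leq_trans IHn) // step.
Qed.

Theorem squarefree_grown n :
  exists w, [/\ grown w, size w = n & aperiodic 1 w].
Proof.
have: (0 < size (layer n))%N.
  by elim: n => // n IHn; have := layer_doubles n; lia.
case def_n: (layer n) => [|w L] // _.
have wn: w \in layer n by rewrite def_n mem_head.
exists w; rewrite (size_layer wn) (grown_layer wn); split=> //.
exact: aperiodic_layer wn.
Qed.

End AperiodicWords.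

(** * Paths in Cayley graphs *)

Local Open Scope group_scope.

Lemma least_spec (S : set nat) n : S n -> S (least S) /\ (least S <= n)%N.
Proof.
move=> Sn; have exS : exists m, `[< S m >] by exists n; apply/asboolP.
case: (ex_minnP exS) => m /asboolP Sm m_min.
have: exists m, [set n | S n /\ forall m, S m -> (n <= m)%N]%classic m.
  by exists m; split=> // k Sk; apply/m_min/asboolP.
by move=> /xgetPex -/(_ 0%N) [] Sl l_min; split; last exact: l_min.
Qed.

Section Cayley.
Variables (K : groupType) (A : seq K).
Implicit Types (g x y : K) (p w : seq K).

Lemma letters_inv g : (g^-1 \in letters A) = (g \in letters A).
Proof.
rewrite !mem_cat; have inv_map h s : (h \in [seq a^-1 | a <- s]) = (h^-1 \in s).
  by rewrite -{1}[h]invgK (mem_map invg_inj).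
by rewrite !inv_map invgK orbC.
Qed.

Lemma spells_cat v w g h :
  spells A v g -> spells A w h -> spells A (v ++ w) (g * h).
Proof.
move=> [vA <-] [wA <-]; split; last by rewrite big_cat.
by move=> a; rewrite mem_cat => /orP[/vA|/wA].
Qed.

Lemma word_length_le w g : spells A w g -> (word_length A g <= size w)%N.
Proof. by move=> wg; apply: (least_spec _).2; exists w. Qed.

Lemma word_length1 : word_length A 1 = 0%N.
Proof. by apply/eqP; rewrite -leqn0 (@word_length_le [::]) // /spells big_nil. Qed.

Lemma path_labels x p : path (cayley_edge A) x p ->
  exists w, [/\ size w = size p, {subset w <= letters A}
    & forall i, (i <= size p)%N ->
        nth x (x :: p) i = x * \prod_(a <- take i w) a].
Proof.
elim: p x => [|y p IHp] x /=.
  by exists [::]; split=> // -[|i] // _; rewrite big_nil mulg1.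
case/andP=> xy /IHp[w [sw wA nth_w]].
exists (x^-1 * y :: w); split=> [|a|[|i] ip].
- by rewrite /= sw.
- by rewrite inE => /predU1P[->|/wA].
- by rewrite big_nil mulg1.
rewrite [LHS](set_nth_default y) //= big_cons -mulgA mulVKg.
exact: nth_w.
Qed.

Lemma path_between x p i j : path (cayley_edge A) x p ->
  (i <= size p)%N -> (j <= size p)%N ->
  exists2 w, spells A w ((nth x (x :: p) i)^-1 * nth x (x :: p) j)
           & size w = ((i - j) + (j - i))%N.
Proof.
move=> px; have [w [sw wA nth_w]] := path_labels px.
wlog le_ij : i j / (i <= j)%N.
  move=> th ip jp; case: (leqP i j) => [|/ltnW] ij; first exact: th.
  case: (th j i ij jp ip) => v [vA vg] sv.
  exists [seq a^-1 | a <- rev v]; last by rewrite size_map size_rev sv addnC.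
  split; last by rewrite big_map prodgV revK vg invgM invgK.
  by move=> a /mapP[b]; rewrite mem_rev => /vA bA ->; rewrite letters_inv.
move=> ip jp; exists (take (j - i) (drop i w)); last first.
  by rewrite size_takel ?size_drop ?sw; lia.
split=> [a /mem_take/mem_drop/wA //|].
rewrite !nth_w // -(subnKC le_ij) takeD big_cat /= invgM -mulgA mulKg mulKg.
by rewrite addKn.
Qed.

(** Needed for [closed_path_length] to be the length of an actual path, rather
than the default value of [least]. *)
Lemma closed_path_exists (A_gen : generates A) (Y : seq K) x :
  exists p, [/\ path (cayley_edge A) x p, last x p = x & {subset Y <= x :: p}].
Proof.
have joined y z : exists2 p, path (cayley_edge A) y p & last y p = z.
  have [w [wA wg]] := A_gen (y^-1 * z).
  have -> : z = y * \prod_(a <- w) a by rewrite wg mulVKg.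
  elim: w y wA {wg} => [|a w IHw] y wA.
    by exists [::]; rewrite ?big_nil ?mulg1.
  have [|p pp lp] := IHw (y * a) _.
    by move=> b bw; apply: wA; rewrite inE bw orbT.
  exists (y * a :: p); last by rewrite /= lp big_cons mulgA.
  by rewrite /= pp andbT /cayley_edge /= mulKg wA ?mem_head.
(* Each new point is visited on a round trip from the base point. *)
elim: Y => [|y Y [p [pp lp Yp]]]; first by exists [::].
have [q xq lq] := joined x y; have [r yr lr] := joined y x.
exists (q ++ r ++ p); split.
- by rewrite !cat_path xq lq yr lr.
- by rewrite !last_cat lq lr.
have yq : y \in x :: q ++ r ++ p by rewrite -cat_cons mem_cat -lq mem_last.
move=> z; rewrite inE => /predU1P[-> //|/Yp].
by rewrite !inE !mem_cat => /orP[->|->]; rewrite ?orbT.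
Qed.

End Cayley.

(** * Alternating cycles in related sets *)

Section RelatedSets.
Variables (K : groupType) (xi : K).
Implicit Types (x y z t : K) (S T : {fset K}).

Lemma relatedP S : related xi [set` S]%classic <->
  forall x, x \in S -> x * xi \in S \/ x * xi^-1 \in S.
Proof.
split=> [rS x /rS[y yS] [<-|<-]|nS x xS].
- by right; rewrite invgM invgK mulVKg.
- by left; rewrite mulVKg.
case: (nS x xS) => yS; [exists (x * xi) | exists (x * xi^-1)] => //.
  by right; rewrite mulKg.
by left; rewrite invgM invgK mulgVK.
Qed.

(** Delete small colour classes one after the other.  When a class Z of at
most d points goes, the points left without a neighbour go too; they lie in
Z xi or Z xi^-1, and as their only neighbours were in Z the remaining points
keep theirs.  Every step costs at most 3 d points and one colour, so the excess
of |S| over 3 d times the number of colours stays positive, and some points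
survive. *)
Lemma related_core d (kap : K -> nat) S : related xi [set` S]%classic ->
  (3 * d * #|` [fset kap x | x in S]%fset| < #|` S|)%N ->
  exists T, [/\ {subset T <= S}, T != fset0%fset, related xi [set` T]%classic
    & forall t, t \in T -> (d < #|` [fset u in T | kap u == kap t]%fset|)%N].
Proof.
have [n] := ubnP #|` S|; elim: n S => // n IHn S Sn rS few.
have [all_big|] := pselect (forall t, t \in S ->
    (d < #|` [fset u in S | kap u == kap t]%fset|)%N).
  exists S; split=> //; by apply: contraTneq few => ->; rewrite cardfs0.
move/existsNP=> [t /not_implyP[tS /negP]]; rewrite -leqNgt.
set Z := [fset u in S | _]%fset => Zd.
pose T := [fset x in S `\` Z | (x * xi \in S `\` Z)
                             || (x * xi^-1 \in S `\` Z)]%fset.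
have TS : (T `<=` S)%fset.
  by apply/fsubsetP => x; rewrite !inE => /andP[/andP[]].
have tT : t \notin T by rewrite !inE eqxx tS.
have rT : related xi [set` T]%classic.
  apply/relatedP => x; rewrite !inE /= => /andP[xSZ] /orP[] ySZ; [left|right].
    by rewrite ySZ mulgK xSZ orbT.
  by rewrite ySZ mulgVK xSZ.
have ST : (#|` S| <= #|` T| + 3 * d)%N.
  have sub : (S `<=` T `|` (Z `|` ([fset (z * xi)%g | z in Z]
                                   `|` [fset (z * xi^-1)%g | z in Z])))%fset.
    apply/fsubsetP => x xS; rewrite in_fsetU.
    case xZ : (x \in Z); first by rewrite !in_fsetU xZ orbT.
    case: ((relatedP S).1 rS x xS) => yS.
      case yZ : (x * xi \in Z).
        rewrite !in_fsetU; apply/orP; right; apply/orP; right; apply/orP; right.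
        by apply/imfsetP; exists (x * xi) => //; rewrite mulgK.
      by move: xZ yZ; rewrite !inE xS yS /= => -> ->.
    case yZ : (x * xi^-1 \in Z).
      rewrite !in_fsetU; apply/orP; right; apply/orP; right; apply/orP; left.
      by apply/imfsetP; exists (x * xi^-1) => //; rewrite mulgVK.
    by move: xZ yZ; rewrite !inE xS yS /= => -> ->; rewrite orbT.
  have := fsubset_leq_card sub.
  set Z1 := [fset _ | _ in _]%fset; set Z2 := [fset _ | _ in _]%fset => le_S.
  have Z1d : (#|` Z1| <= d)%N by apply: leq_trans Zd; apply: leq_imfset_card.
  have Z2d : (#|` Z2| <= d)%N by apply: leq_trans Zd; apply: leq_imfset_card.
  apply: (leq_trans le_S); apply: (leq_trans (leq_card_fsetU _ _).1).
  rewrite leq_add2l mulSn; apply: (leq_trans (leq_card_fsetU _ _).1).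
  apply: leq_add => //; apply: (leq_trans (leq_card_fsetU _ _).1).
  by rewrite mul2n -addnn leq_add.
have kapT : (#|` [fset kap x | x in T]%fset|
             < #|` [fset kap x | x in S]%fset|)%N.
  apply: fproper_ltn_card; rewrite fproperE; apply/andP; split; apply/fsubsetP.
    move=> k /imfsetP[x xT ->]; apply/imfsetP; exists x => //.
    exact: (fsubsetP TS).
  move=> /(_ (kap t)); case/(_ _)/imfsetP; first by apply/imfsetP; exists t.
  move=> x /=; rewrite !inE => /andP[/andP[+ xS] _] ktx.
  by rewrite xS ktx eqxx.
have [||U [UT U0 rU bigU]] := IHn T _ rT.
- rewrite -ltnS; apply: leq_trans Sn; rewrite ltnS.
  apply: fproper_ltn_card; rewrite fproperE TS /=.
  by apply/fsubsetP => /(_ t tS); rewrite (negPf tT).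
- by move: few kapT ST; nia.
by exists U; split=> // x /UT; apply: (fsubsetP TS).
Qed.

(** In this section a set [T] is walked backwards: the head letter of a word is
the last one to be added, and [vertex w] is the point from which [w], with its
signs, leads to [z0].  From [z] one steps back to some [t <> z] of the same
colour, which is the letter [t^-1 * z], and then jumps back to the partner of
[t]; so the next vertex is [partner (z * a^-1)] for the letter [a]. *)
Section Cycle.
Variables (kap : K -> nat) (T : {fset K}).
Hypothesis rT : related xi [set` T]%classic.
Hypothesis wide : forall t,
  t \in T -> (4 < #|` [fset u in T | kap u == kap t]%fset|)%N.
Variable z0 : K.
Hypothesis z0T : z0 \in T.

Let sign t : bool := t * xi^-1 \notin T.
Let partner t : K := t * (sign_pow xi (sign t))^-1.

Let partner_in t : t \in T -> partner t \in T.
Proof.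
rewrite /partner /sign => tT; case: (boolP (t * xi^-1 \in T)) => //= /negPf ntT.
by rewrite invgK; case: ((relatedP T).1 rT t tT) => //; rewrite ntT.
Qed.

Let vertex : seq K -> K := foldr (fun a z => partner (z * a^-1)) z0.
Let near z : {fset K} := ([fset u in T | kap u == kap z] `\ z)%fset.
Let next w : seq K := [seq t^-1 * vertex w | t <- near (vertex w)].

Let vertex_in w : grown next w -> vertex w \in T.
Proof.
elim: w => [|a w IHw] //= /andP[/mapP[t]] tN -> /IHw _.
rewrite invgM invgK mulVKg; apply: partner_in.
by move: tN; rewrite !inE => /and3P[].
Qed.

Let next_wide w : grown next w -> uniq (next w) /\ (4 <= size (next w))%N.
Proof.
move=> /vertex_in wT; split.
  by rewrite map_inj_uniq ?fset_uniq // => t u /mulIg /invg_inj.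
rewrite size_map; have := wide wT.
by rewrite (cardfsD1 (vertex w)) !inE wT eqxx.
Qed.

Let next_nontrivial w a : grown next w -> a \in w ->
  exists u v, [/\ u \in T, v \in T, u != v, kap u = kap v & a = u^-1 * v].
Proof.
elim: w => [|b w IHw] //= /andP[/mapP[t tN def_b] gw]; rewrite inE.
case/predU1P=> [->|]; last exact: IHw.
exists t, (vertex w); rewrite def_b vertex_in //.
by move: tN; rewrite !inE => /and3P[tv tT /eqP].
Qed.

Let signed : seq K -> seq (bool * K) :=
  fix signed w :=
    if w is a :: w' then (sign (vertex w' * a^-1), a) :: signed w' else [::].

Let unzip2_signed w : unzip2 (signed w) = w.
Proof. by elim: w => //= a w ->. Qed.

Let drop_signed p w : drop p (signed w) = signed (drop p w).
Proof. by elim: p w => [|p IHp] [|a w] //=. Qed.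

Let prod_signed w :
  \prod_(q <- signed w) (sign_pow xi q.1 * q.2) = (vertex w)^-1 * z0.
Proof.
elim: w => [|a w IHw] /=; first by rewrite big_nil mulVg.
by rewrite big_cons IHw /partner /= !invgM !invgK -!mulgA.
Qed.

Lemma squarefree_cycle : exists ps : seq (bool * K),
  [/\ ps != [::], aperiodic 1 (unzip2 ps),
      forall a, a \in unzip2 ps ->
        exists u v,
          [/\ u \in T, v \in T, u != v, kap u = kap v & a = u^-1 * v]
    & \prod_(q <- ps) (sign_pow xi q.1 * q.2) = 1].
Proof.
have [w [gw sw w_sqf]] := squarefree_grown next_wide #|` T|.
(* The walk has one vertex more than T, hence visits some vertex twice. *)
pose s := [seq vertex (drop i w) | i <- iota 0 #|` T|.+1].
have sT : {subset s <= enum_fset T}.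
  by move=> x /mapP[i _ ->]; apply/vertex_in/grown_drop.
have: ~~ uniq s.
  apply/negP => us; have := uniq_leq_size us sT.
  by rewrite size_map size_iota ltnn.
move/(uniqPn 1) => [i [j [ij]]]; rewrite size_map size_iota => jT.
have iT := ltn_trans ij jT.
rewrite !(nth_map 0%N) ?size_iota // !nth_iota // !add0n => eq_v.
set wi := drop i w in eq_v; set m := (j - i)%N.
have def_wj : drop j w = drop m wi by rewrite drop_drop subnK // ltnW.
exists (take m (signed wi)); have unz : unzip2 (take m (signed wi)) = take m wi.
  by rewrite /unzip2 map_take -/(unzip2 _) unzip2_signed.
have winf : infix (take m wi) w.
  have := prefix_infix (take m wi) (drop m wi); rewrite cat_take_drop.
  move=> /infix_trans; apply.
  by have := suffix_infix (take i w) wi; rewrite cat_take_drop.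
split.
- rewrite -size_eq0 -(size_map snd) -/(unzip2 _) unz.
  by rewrite size_take_min size_drop sw; lia.
- by rewrite unz; apply: aperiodic_infix winf w_sqf.
- by move=> a; rewrite unz => /(mem_infix winf); apply: next_nontrivial.
have := prod_signed wi; rewrite -{1}(cat_take_drop m (signed wi)) big_cat /=.
rewrite drop_signed prod_signed -def_wj -eq_v => /(canRL (mulgK _)) ->.
by rewrite mulgV.
Qed.

End Cycle.

End RelatedSets.

(** * Aperiodic products and TS groups *)

Lemma nontrivial_letter (K : groupType) (A : seq K) :
  generates A -> (exists g : K, g != 1) -> exists2 a, a \in letters A & a != 1.
Proof.
move=> A_gen [g g1]; apply/hasP; apply: contraNT g1 => /hasPn triv.
have [w [wA <-]] := A_gen g; rewrite big1_seq // => a /andP[_ /wA /triv].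
by move=> /negPn/eqP.
Qed.

Lemma alternating_productE (K : groupType) (xi : K) (ps : seq (bool * K)) :
  alternating_product xi [tuple of map fst (in_tuple ps)]
    [tuple of map snd (in_tuple ps)]
  = \prod_(q <- ps) (sign_pow xi q.1 * q.2).
Proof.
rewrite (big_tnth _ _ ps); apply: eq_bigr => i _.
by rewrite !tnth_map.
Qed.

Lemma aperiodic_products_long (R : realType) (K : groupType) (A : seq K) n l :
  property_P' R A n -> (0 < l)%N ->
  exists xi : K, forall ps : seq (bool * K),
    ps != [::] -> aperiodic n (unzip2 ps) ->
    (forall a, a \in unzip2 ps -> a != 1 /\ (word_length A a <= l)%N) ->
    (l < word_length A (\prod_(q <- ps) (sign_pow xi q.1 * q.2)))%N.
Proof.
move=> PA l0; have [|xi xiP] := PA l%:R%R; first by rewrite ltr0n.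
exists xi => ps ps0 ps_ap ps_short; rewrite -alternating_productE -(ltr_nat R).
apply: xiP => //; first by rewrite lt0n size_eq0.
move=> i; have [|x1 xl] := ps_short (tnth [tuple of map snd (in_tuple ps)] i).
  exact: mem_tnth.
by rewrite ler_nat.
Qed.

Lemma same_quotient_dist d i j : (0 < d)%N -> (i %/ d = j %/ d)%N ->
  ((i - j) + (j - i) <= d)%N.
Proof.
move=> d0 ij; have := divn_eq i d; have := divn_eq j d; rewrite ij.
by have := ltn_pmod i d0; have := ltn_pmod j d0; lia.
Qed.

(** The number of colours is at most L / l + 1 <= 2 L / l < 2 N |S| / l, and
[related_core] with d = 4 wants it below |S| / 12: hence l = 24 N. *)
Theorem property_P'_ts (R : realType) (K : groupType) (A : seq K) n :
  generates A -> (exists g : K, g != 1) -> (0 < n)%N ->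
  property_P' R A n -> ts_group R A.
Proof.
move=> A_gen K1 n0 PA lambda lambda1; pose N := Num.bound lambda.
have lambdaN : (lambda < N%:R)%R.
  by apply: archi_boundP; apply: ltW; apply: lt_trans lambda1.
have N0 : (0 < N)%N.
  by rewrite -(ltr_nat R); apply: lt_trans lambdaN; apply: lt_trans lambda1.
pose l := (24 * N)%N; have l0 : (0 < l)%N by rewrite muln_gt0.
have [xi xiP] := aperiodic_products_long PA l0; exists xi => S rS.
have [->|[s0 s0S]] := fset_0Vmem S; first by rewrite cardfs0 mulr0.
have [q [q_path q_last Sq]] := closed_path_exists A_gen S 1.
(* A shortest closed path through S. *)
have [[x [p [p_path _ Sp def_L]]] _] := @least_spec
  [set n | exists x p, [/\ path (cayley_edge A) x p, last x p = x,
     {subset S <= x :: p} & size p = n]]%classic (size q)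
  (ex_intro _ 1 (ex_intro _ q (And4 q_path q_last Sq erefl))).
rewrite -[least _]/(closed_path_length A S) in def_L.
set L := closed_path_length A S in def_L *; rewrite leNgt; apply/negP => short.
have {short lambdaN} short : (L < N * #|` S|)%N.
  rewrite -(ltr_nat R) natrM; apply: (lt_le_trans short).
  by apply: ler_wpM2r (ltW lambdaN).
have between u v : u \in S -> v \in S ->
    exists2 w, spells A w (u^-1 * v)
      & size w = ((index u (x :: p) - index v (x :: p))
                  + (index v (x :: p) - index u (x :: p)))%N.
  move=> /Sp up /Sp vp; have := up; have := vp; rewrite -!index_mem /= !ltnS.
  move=> vi ui; have := path_between p_path ui vi.
  by rewrite !nth_index.
have index_le u : u \in S -> (index u (x :: p) <= L)%N.
  by move=> /Sp; rewrite -index_mem /= def_L ltnS.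
(* The path joins two points differing by xi or its inverse, and one more edge,
   labelled by a nontrivial generator, gives a product longer than l. *)
have l_le_L : (l <= L)%N.
  have [a aA a1] := nontrivial_letter A_gen K1.
  have a_spell : spells A [:: a] a.
    by split; [move=> b; rewrite inE => /eqP-> | rewrite big_seq1].
  have [b [w [w_spell w_size]]] :
      exists b w, spells A w (sign_pow xi b) /\ (size w <= L)%N.
    have [b [t tS def_t]] :
        exists b, exists2 t, t \in S & s0^-1 * t = sign_pow xi b.
      case: ((relatedP xi S).1 rS s0 s0S) => tS.
        by exists false, (s0 * xi); rewrite // mulKg.
      by exists true, (s0 * xi^-1); rewrite // mulKg.
    have [w wt sw] := between _ _ s0S tS.
    exists b, w; rewrite -def_t; split=> //.
    by rewrite sw; have := index_le _ s0S; have := index_le _ tS; lia.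
  have := xiP [:: (b, a)] isT (aperiodic_seq1 _ n0); rewrite big_seq1 /= => xia.
  have: (l < word_length A (sign_pow xi b * a))%N.
    apply: xia => c; rewrite inE => /eqP->; split=> //.
    exact: leq_trans (word_length_le a_spell) l0.
  have := word_length_le (spells_cat w_spell a_spell); rewrite size_cat /=.
  by lia.
pose kap u := (index u (x :: p) %/ l)%N.
have few_colors : (#|` [fset kap u | u in S]%fset| <= (L %/ l).+1)%N.
  rewrite -[leqRHS](size_iota 0); apply: uniq_leq_size => // k.
  move=> /imfsetP[u uS ->]; rewrite mem_iota ltnS.
  exact: leq_div2r (index_le u uS).
have [|T [TS T0 rT wide]] := @related_core _ xi 4 kap S rS.
  have pieces : ((L %/ l).+1 * l <= 2 * L)%N.
    by rewrite mulSn mul2n -addnn leq_add // leq_divM.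
  have : (#|` [fset kap u | u in S]%fset| * l <= 2 * L)%N.
    by apply: leq_trans pieces; rewrite leq_mul2r few_colors orbT.
  move=> le_2L; rewrite -(ltn_pmul2l N0); apply: leq_ltn_trans short.
  by move: le_2L; rewrite /l; lia.
have [z0 z0T] := fset0Pn _ T0.
have [ps [ps0 ps_sqf ps_short ps1]] := squarefree_cycle rT wide z0T.
suff: (l < word_length A (\prod_(q <- ps) (sign_pow xi q.1 * q.2)))%N.
  by rewrite ps1 word_length1.
apply: xiP => //; first exact: aperiodicW ps_sqf.
move=> a /ps_short[u [v [uT vT uv kap_uv ->]]]; split.
  by apply: contra uv => /eqP /mulg1_eq; rewrite invgK => ->.
have [w uv_spell sw] := between u v (TS u uT) (TS v vT).
apply: leq_trans (word_length_le uv_spell) _; rewrite sw.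
exact: (same_quotient_dist l0 kap_uv).
Qed.

Theorem proposition5 (R : realType) (K : groupType) (A : seq K)
    (A_gen : generates A) (K_nontrivial : exists g : K, g != 1%g) :
  (property_P' R A 10 -> ts_group R A) /\ (property_P R A -> ts_group R A).
Proof.
have P'_ts : property_P' R A 10 -> ts_group R A by exact: property_P'_ts.
split=> // PA; apply: P'_ts => r r0; have [xi xiP] := PA r r0.
by exists xi => k x e k0 _; apply: xiP.
Qed.
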